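(* Let $s\ge 1$ and let $a_{ij}, b_i$ ($i,j=1,\dots,s$) be real numbers satisfying $$b_i a_{ij}+b_j a_{ji}=b_i b_j,\qquad b_i\ge 0,\qquad \forall\, i,j=1,\dots,s .$$ Then the $s$-stage HSAV-RK method with these coefficients (defined in the context) is unconditionally energy stable: for every time step $\Delta t>0$, every given $(\phi^n,q^n)$, and every $(\Phi_i,Q_i,k_i,l_i)_{i=1}^s$, $(\phi^{n+1},q^{n+1})$ produced from it by the method, $$E^{n+1}-E^n=\Delta t\sum_{i=1}^s b_i\Big(\mathcal L\Phi_i+\frac{Q_i g'(\Phi_i)}{\sqrt{(g(\Phi_i),1)+C_0}},\ \mathcal G\Big[\mathcal L\Phi_i+\frac{Q_i g'(\Phi_i)}{\sqrt{(g(\Phi_i),1)+C_0}}\Big]\Big)\le 0,$$ where $E^{m}=\frac12(\mathcal L\phi^{m},\phi^{m})+(q^{m})^2-C_0$ for $m=n,n+1$.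
   Context: Setting. $\Omega$ is a spatial domain (periodic boundary conditions are assumed), $(f,h)=\int_\Omega f h\,d\mathbf x$ is the real $L^2(\Omega)$ inner product. $\mathcal L$ is a linear self-adjoint operator, $(\mathcal L\phi,\psi)=(\phi,\mathcal L\psi)$, and $\mathcal G$ is a negative semi-definite operator, $(\psi,\mathcal G\psi)\le 0$, for all $\phi,\psi$ in the relevant domains in $L^2(\Omega)$. $g:\mathbb R\to\mathbb R$ is a differentiable function with derivative $g'$ (applied pointwise to functions on $\Omega$), and $C_0>0$ is a constant with $(g(\phi),1)+C_0>0$ for all $\phi$ considered. All functions are real-valued and regular enough for the expressions to make sense: $\phi^n,k_i$ lie in the domain of $\mathcal L$ (a linear subspace of $L^2(\Omega)$ on which the symmetry identity holds), $g(\Phi_i)\in L^1(\Omega)$, $g'(\Phi_i)\in L^2(\Omega)$, and the functions to which $\mathcal G$ is applied lie in the domain of $\mathcal G$, with values in $L^2(\Omega)$. The underlying system (scalar auxiliary variable reformulation of the gradient flow $\partial_t\phi=\mathcal G(\mathcal L\phi+g'(\phi))$) is $$\partial_t\phi=\mathcal G\Big(\mathcal L\phi+\frac{q g'(\phi)}{\sqrt{(g(\phi),1)+C_0}}\Big),\qquad \partial_t q=\Big(\frac{g'(\phi)}{2\sqrt{(g(\phi),1)+C_0}},\partial_t\phi\Big),$$ with $\phi=\phi(\mathbf x,t)$ and $q=q(t)\in\mathbb R$. $s$-stage HSAV-RK method. Let $b_i,a_{ij}$ be real and $c_i=\sum_{j=1}^s a_{ij}$. Given $(\phi^n,q^n)$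 ($\phi^n$ a function on $\Omega$, $q^n\in\mathbb R$), the intermediate values $\Phi_i,k_i$ (functions on $\Omega$) and $Q_i,l_i\in\mathbb R$, $i=1,\dots,s$, satisfy $$\Phi_i=\phi^n+\Delta t\sum_{j=1}^s a_{ij}k_j,\qquad Q_i=q^n+\Delta t\sum_{j=1}^s a_{ij}l_j,$$ $$k_i=\mathcal G\Big(\mathcal L\Phi_i+\frac{Q_i g'(\Phi_i)}{\sqrt{(g(\Phi_i),1)+C_0}}\Big),\qquad l_i=\Big(\frac{g'(\Phi_i)}{2\sqrt{(g(\Phi_i),1)+C_0}},k_i\Big),$$ and then $$\phi^{n+1}=\phi^n+\Delta t\sum_{i=1}^s b_i k_i,\qquad q^{n+1}=q^n+\Delta t\sum_{i=1}^s b_i l_i .$$ *)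

(* Defs.v *)
From HB Require Import structures.
From mathcomp Require Import all_boot all_order all_algebra.
From mathcomp Require Import all_classical all_reals all_analysis.

Set Implicit Arguments.
Unset Strict Implicit.
Unset Printing Implicit Defensive.
Import Order.TTheory GRing.Theory Num.Theory.
Import numFieldNormedType.Exports.
Local Open Scope classical_set_scope.
Local Open Scope ring_scope.

(* The spatial domain Omega is the whole space T, and dx is mu: a box or torus
   with Lebesgue measure is an instance. Boundary conditions are carried by the
   domains of the operators. Elements of L^2(Omega) are represented by
   functions T -> R in [Lfun mu 2], identified up to equality mu-a.e. *)

Section Inner.
Context {d : measure_display} {T : measurableType d} {R : realType}.
Variable mu : {measure set T -> \bar R}.

Definition inner (f h : T -> R) : R := \int[mu]_x (f x * h x).

(* An operator on L^2(Omega) with domain [op_dom]; [op_fun] is meaningful on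
   [op_dom] only. The two a.e. fields say that domain and values depend only on
   the class of the argument. *)
Record L2_operator := {
  op_dom : set (T -> R);
  op_fun :> (T -> R) -> T -> R;
  op_dom_L2 : forall f, op_dom f -> f \in Lfun mu 2%:E;
  op_val_L2 : forall f, op_dom f -> op_fun f \in Lfun mu 2%:E;
  op_dom_ae : forall f h, op_dom f -> h \in Lfun mu 2%:E ->
    f = h %[ae mu] -> op_dom h;
  op_fun_ae : forall f h, op_dom f -> op_dom h ->
    f = h %[ae mu] -> op_fun f = op_fun h %[ae mu] }.

Definition linear_operator (A : L2_operator) : Prop :=
  [/\ op_dom A (fun=> 0),
      forall (c : R) f h, op_dom A f -> op_dom A h ->
        op_dom A (fun x => c * f x + h x)
    & forall (c : R) f h, op_dom A f -> op_dom A h ->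
        A (fun x => c * f x + h x) = (fun x => c * A f x + A h x) %[ae mu]].

Definition self_adjoint (A : L2_operator) : Prop :=
  forall f h, op_dom A f -> op_dom A h -> inner (A f) h = inner f (A h).

Definition negative_semidefinite (A : L2_operator) : Prop :=
  forall f, op_dom A f -> inner f (A f) <= 0.

End Inner.

Section HSAV.
Context {d : measure_display} {T : measurableType d} {R : realType}.
Variable mu : {measure set T -> \bar R}.
Variables (L G : L2_operator mu) (g : R -> R) (C0 : R).

Definition sav_root (f : T -> R) : R :=
  Num.sqrt (inner mu (g \o f) (cst 1) + C0).

Definition chem_pot (f : T -> R) (q : R) : T -> R :=
  fun x => L f x + q * derive1 g (f x) / sav_root f.

Definition energy (f : T -> R) (q : R) : R :=
  2^-1 * inner mu (L f) f + q ^+ 2 - C0.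

Record hsav_rk (s : nat) (a : 'I_s -> 'I_s -> R) (b : 'I_s -> R) (dt : R)
    (phi : T -> R) (q : R)
    (Phi : 'I_s -> T -> R) (Q : 'I_s -> R) (k : 'I_s -> T -> R) (l : 'I_s -> R)
    (phi1 : T -> R) (q1 : R) : Prop := {
  hsav_Phi : forall i,
    Phi i = (fun x => phi x + dt * \sum_(j < s) a i j * k j x) %[ae mu];
  hsav_Q : forall i, Q i = q + dt * \sum_(j < s) a i j * l j;
  hsav_k : forall i, k i = G (chem_pot (Phi i) (Q i)) %[ae mu];
  hsav_l : forall i,
    l i = inner mu (fun x => derive1 g (Phi i x) / (2 * sav_root (Phi i))) (k i);
  hsav_phi1 : phi1 = (fun x => phi x + dt * \sum_(i < s) b i * k i x) %[ae mu];
  hsav_q1 : q1 = q + dt * \sum_(i < s) b i * l i }.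

End HSAV.

(* Main.v *)
Require Import Defs.
From HB Require Import structures.
From mathcomp Require Import all_boot all_order all_algebra.
From mathcomp Require Import all_classical all_reals all_analysis.
From mathcomp Require Import ring.

Set Implicit Arguments.
Unset Strict Implicit.
Unset Printing Implicit Defensive.
Import Order.TTheory GRing.Theory Num.Theory.
Import numFieldNormedType.Exports.
Local Open Scope classical_set_scope.
Local Open Scope ring_scope.

(** A Runge-Kutta method with [b_i a_ij + b_j a_ji = b_i b_j] conserves the
    balance law of every quadratic form. Applied to the quadratic forms
    [(L phi, phi) / 2] and [q ^ 2], it turns the energy increment into
    [dt * sum_i b_i ((L Phi_i, k_i) + 2 Q_i l_i)]. By the definition of [l_i]
    the summand is the pairing of [k_i] with the chemical potential of stage
    [i], whose image under [G] is [k_i]. *)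

(** Exchanging the two summation indices in one of the two copies of the right-hand sum and using
    the symmetry of [S], the coefficient of [S i j] becomes [b i * a i j + b j * a j i], which is
    [b i * b j]. *)
Lemma sum_rk_symmetric (R : realType) (s : nat) (a : 'I_s -> 'I_s -> R)
    (b : 'I_s -> R) (S : 'I_s -> 'I_s -> R) :
  (forall i j, b i * a i j + b j * a j i = b i * b j) ->
  (forall i j, S i j = S j i) ->
  \sum_i b i * (\sum_j b j * S i j) = 2 * \sum_i b i * (\sum_j a i j * S i j).
Proof.
move=> ab Ssym; rewrite mulr2n mulrDl mul1r.
under eq_bigr do rewrite mulr_sumr.
under [in RHS]eq_bigr do rewrite mulr_sumr.
rewrite [X in _ = X + _]exchange_big /= -big_split /=; apply: eq_bigr => i _.
rewrite -big_split /=; apply: eq_bigr => j _.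
by rewrite mulrA -ab mulrDl addrC !mulrA (Ssym j i).
Qed.

(** For a symmetric bilinear form, [u0] stands for its value at the old state, [v i] for the pairing
    of the old state with the slope of stage [i], and [S i j] for the pairing of two slopes. The
    left side is then the increment of the quadratic form over one step, and each bracket on the
    right pairs stage [i] with its own slope. Only scalars occur, so the identity serves functions
    and real numbers alike. *)
Lemma rk_quadratic_increment (R : realType) (s : nat) (a : 'I_s -> 'I_s -> R)
    (b : 'I_s -> R) (dt u0 : R) (v : 'I_s -> R) (S : 'I_s -> 'I_s -> R) :
  (forall i j, b i * a i j + b j * a j i = b i * b j) ->
  (forall i j, S i j = S j i) ->
  (u0 + dt * \sum_i b i * v i) +
    dt * (\sum_i b i * (v i + dt * \sum_j b j * S i j)) - u0 =
  dt * \sum_i b i * (2 * (v i + dt * \sum_j a i j * S i j)).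
Proof.
move=> ab Ssym; have Sab := sum_rk_symmetric ab Ssym.
have -> : \sum_i b i * (v i + dt * \sum_j b j * S i j) =
    \sum_i b i * v i + dt * \sum_i b i * (\sum_j b j * S i j).
  by rewrite mulr_sumr -big_split; apply: eq_bigr => i _ /=; ring.
have -> : \sum_i b i * (2 * (v i + dt * \sum_j a i j * S i j)) =
    2 * (\sum_i b i * v i) + dt * (2 * \sum_i b i * (\sum_j a i j * S i j)).
  by rewrite !mulr_sumr -big_split; apply: eq_bigr => i _ /=; ring.
by rewrite Sab; ring.
Qed.

Section InnerTheory.
Context {d : measure_display} {T : measurableType d} {R : realType}.
Variable mu : {measure set T -> \bar R}.
Implicit Types (f h u : T -> R) (c : R).

Lemma innerC f h : inner mu f h = inner mu h f.
Proof. by apply: eq_Rintegral => x _; rewrite mulrC. Qed.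

Lemma integrable_inner f h : f \in Lfun mu 2%:E -> h \in Lfun mu 2%:E ->
  mu.-integrable setT (EFin \o (fun x => f x * h x)).
Proof. by move=> f2 h2; apply/Lfun1_integrable; exact: Lfun2_mul_Lfun1. Qed.

(** The scheme holds only almost everywhere, so its equations enter inner products through this
    lemma. Membership in L^2 supplies the measurability of the two products. *)
Lemma ae_eq_inner f h u :
  f \in Lfun mu 2%:E -> h \in Lfun mu 2%:E -> u \in Lfun mu 2%:E ->
  f = h %[ae mu] -> inner mu f u = inner mu h u.
Proof.
move=> f2 h2 u2 fh; rewrite /inner /Rintegral; congr fine.
apply: ae_eq_integral => //.
- exact: measurable_int (integrable_inner f2 u2).
- exact: measurable_int (integrable_inner h2 u2).
- by apply: filterS fh => x /[apply] ->.
Qed.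

Lemma Lfun2_linear c f h : f \in Lfun mu 2%:E -> h \in Lfun mu 2%:E ->
  (fun x => c * f x + h x) \in Lfun mu 2%:E.
Proof.
have le12 : (1 <= 2%:E :> \bar R)%E by rewrite lee_fin ler1n.
by move=> f2 h2; have [_ +] := Lfun_submod_closed mu le12; apply.
Qed.

Lemma inner_linear c f h u :
  f \in Lfun mu 2%:E -> h \in Lfun mu 2%:E -> u \in Lfun mu 2%:E ->
  inner mu (fun x => c * f x + h x) u = c * inner mu f u + inner mu h u.
Proof.
move=> f2 h2 u2; have fu := integrable_inner f2 u2.
rewrite /inner -RintegralZl // -RintegralD //; last exact: integrable_inner.
- by apply: eq_Rintegral => x _; rewrite mulrDl mulrA.
- exact: (@integrableZl _ _ _ mu setT measurableT c _ fu).
Qed.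

Lemma Lfun2_0 : (fun=> 0) \in Lfun mu 2%:E.
Proof.
have le12 : (1 <= 2%:E :> \bar R)%E by rewrite lee_fin ler1n.
by have [+ _] := Lfun_submod_closed mu le12.
Qed.

Lemma inner0 u : inner mu (fun=> 0) u = 0.
Proof.
rewrite /inner; under eq_Rintegral do rewrite mul0r.
by rewrite Rintegral_cst // mul0r.
Qed.

Lemma Lfun2_sum (I : Type) (r : seq I) (c : I -> R) (k : I -> T -> R) :
  (forall i, k i \in Lfun mu 2%:E) ->
  (fun x => \sum_(i <- r) c i * k i x) \in Lfun mu 2%:E.
Proof.
move=> k2; elim: r => [|i r IHr].
  by under eq_fun do rewrite big_nil; exact: Lfun2_0.
by under eq_fun do rewrite big_cons; exact: Lfun2_linear.
Qed.

Lemma inner_sum (I : Type) (r : seq I) (c : I -> R) (k : I -> T -> R) u :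
  (forall i, k i \in Lfun mu 2%:E) -> u \in Lfun mu 2%:E ->
  inner mu (fun x => \sum_(i <- r) c i * k i x) u =
  \sum_(i <- r) c i * inner mu (k i) u.
Proof.
move=> k2 u2; elim: r => [|i r IHr].
  by rewrite big_nil; under eq_fun do rewrite big_nil; exact: inner0.
under eq_fun do rewrite big_cons.
by rewrite big_cons inner_linear ?IHr //; exact: Lfun2_sum.
Qed.

Lemma linear_op_dom_sum (A : L2_operator mu) (I : Type) (r : seq I)
    (c : I -> R) (k : I -> T -> R) :
  linear_operator A -> (forall i, op_dom A (k i)) ->
  op_dom A (fun x => \sum_(i <- r) c i * k i x).
Proof.
move=> [A0 Alin _] kA; elim: r => [|i r IHr].
  by under eq_fun do rewrite big_nil.
by under eq_fun do rewrite big_cons; exact: Alin.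
Qed.

End InnerTheory.

Theorem theorem3p1
  (d : measure_display) (T : measurableType d) (R : realType)
  (mu : {measure set T -> \bar R})
  (L G : L2_operator mu) (g : R -> R) (C0 : R)
  (L_linear : linear_operator L)
  (L_self_adjoint : self_adjoint L)
  (G_negative : negative_semidefinite G)
  (g_derivable : forall x : R, derivable g x 1)
  (C0_gt0 : 0 < C0)
  (s : nat) (s_ge1 : (1 <= s)%N)
  (a : 'I_s -> 'I_s -> R) (b : 'I_s -> R)
  (ab : forall i j, b i * a i j + b j * a j i = b i * b j)
  (b_ge0 : forall i, 0 <= b i)
  (dt : R) (dt_gt0 : 0 < dt)
  (phi : T -> R) (q : R)
  (Phi : 'I_s -> T -> R) (Q : 'I_s -> R) (k : 'I_s -> T -> R) (l : 'I_s -> R)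
  (phi1 : T -> R) (q1 : R)
  (phi_dom : op_dom L phi)
  (k_dom : forall i, op_dom L (k i))
  (Phi_L2 : forall i, Phi i \in Lfun mu 2%:E)
  (phi1_L2 : phi1 \in Lfun mu 2%:E)
  (gPhi_L1 : forall i, g \o Phi i \in Lfun mu 1%E)
  (gPhi_C0 : forall i, 0 < inner mu (g \o Phi i) (cst 1) + C0)
  (dgPhi_L2 : forall i, derive1 g \o Phi i \in Lfun mu 2%:E)
  (chem_pot_dom : forall i, op_dom G (chem_pot L g C0 (Phi i) (Q i)))
  (scheme : hsav_rk L G g C0 a b dt phi q Phi Q k l phi1 q1) :
  energy L C0 phi1 q1 - energy L C0 phi q =
    dt * \sum_(i < s) b i * inner mu (chem_pot L g C0 (Phi i) (Q i))
                                     (G (chem_pot L g C0 (Phi i) (Q i)))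
  /\ dt * \sum_(i < s) b i * inner mu (chem_pot L g C0 (Phi i) (Q i))
                                      (G (chem_pot L g C0 (Phi i) (Q i))) <= 0.
Proof.
have [_ L_dom _] := L_linear.
have k_L2 i : k i \in Lfun mu 2%:E := op_dom_L2 (k_dom i).
have phi_L2 : phi \in Lfun mu 2%:E := op_dom_L2 phi_dom.
(* Up to a.e. equality, the weights [c = a i] give the stage [Phi i] and [c = b] gives [phi1], so
   both are handled at once. *)
pose comb (c : 'I_s -> R) x := phi x + dt * \sum_(j < s) c j * k j x.
have combE c : comb c = fun x => dt * (\sum_(j < s) c j * k j x) + phi x.
  by apply/funext => x; rewrite addrC.
have sum_dom c : op_dom L (fun x => \sum_(j < s) c j * k j x).
  exact: linear_op_dom_sum.
have comb_dom c : op_dom L (comb c) by rewrite combE; exact: L_dom.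
have ae_comb_dom c f : f \in Lfun mu 2%:E -> f = comb c %[ae mu] -> op_dom L f.
  by move=> f2 fc; apply: (op_dom_ae (comb_dom c) f2); exact: ae_eq_sym.
(* With [L] on the second argument, linearity in the first is that of the integral; the symmetry
   [BC] carries it over to the second. *)
pose B f h := inner mu f (L h).
have BC f h : op_dom L f -> op_dom L h -> B f h = B h f.
  by move=> fd hd; rewrite /B -L_self_adjoint // innerC.
have B_comb c f h : f \in Lfun mu 2%:E -> f = comb c %[ae mu] -> op_dom L h ->
    B f h = B phi h + dt * \sum_(j < s) c j * B (k j) h.
  move=> f2 fc hd; have Lh2 := op_val_L2 hd.
  rewrite /B (ae_eq_inner f2 (op_dom_L2 (comb_dom c)) Lh2 fc) combE.
  by rewrite inner_linear ?inner_sum // 1?addrC //; exact: op_dom_L2 (sum_dom c).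
have phi1_dom : op_dom L phi1 := ae_comb_dom _ _ phi1_L2 (hsav_phi1 scheme).
have Phi_dom i : op_dom L (Phi i) :=
  ae_comb_dom _ _ (Phi_L2 i) (hsav_Phi scheme i).
have L_increment : B phi1 phi1 - B phi phi =
    dt * \sum_i b i * (2 * B (Phi i) (k i)).
  (* Expand one argument [phi1], swap by symmetry, then expand the other, to reach the shape of
     [rk_quadratic_increment] with [v i = B (k i) phi] and [S i j = B (k i) (k j)]. *)
  rewrite (B_comb b _ _ phi1_L2 (hsav_phi1 scheme)) // BC //.
  rewrite (B_comb b _ _ phi1_L2 (hsav_phi1 scheme)) //.
  have -> : \sum_j b j * B (k j) phi1 =
      \sum_j b j * (B (k j) phi + dt * \sum_i b i * B (k j) (k i)).
    apply: eq_bigr => j _; rewrite BC //.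
    rewrite (B_comb b _ _ phi1_L2 (hsav_phi1 scheme)) // BC //.
    by under eq_bigr do rewrite BC //.
  rewrite (rk_quadratic_increment _ _ _ ab) => [|i j]; last exact: BC.
  congr (_ * _); apply: eq_bigr => i _; congr (_ * (_ * _)).
  rewrite (B_comb (a i) _ _ (Phi_L2 i) (hsav_Phi scheme i)) // BC //.
  by under eq_bigr do rewrite BC //.
have q_increment : q1 ^+ 2 - q ^+ 2 = dt * \sum_i b i * (2 * (Q i * l i)).
  (* The same identity for the product of reals, with [v i = q * l i] and [S i j = l i * l j].
     Writing D for the sum of the [b i * l i], the two sums are q D and [q1] D, and
     [q1 = q + dt * D] gives [q1 ^+ 2]. *)
  transitivity ((q ^+ 2 + dt * \sum_i b i * (q * l i)) +
      dt * (\sum_i b i * (q * l i + dt * \sum_j b j * (l i * l j))) - q ^+ 2).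
    congr (_ - _); have q1E := hsav_q1 scheme.
    have -> : \sum_i b i * (q * l i) = q * \sum_i b i * l i.
      by rewrite mulr_sumr; apply: eq_bigr => i _; ring.
    have -> : \sum_i b i * (q * l i + dt * \sum_j b j * (l i * l j)) =
        q1 * \sum_i b i * l i.
      rewrite mulr_sumr; apply: eq_bigr => i _.
      have -> : \sum_j b j * (l i * l j) = l i * \sum_j b j * l j.
        by rewrite mulr_sumr; apply: eq_bigr => j _; ring.
      by rewrite q1E; ring.
    by rewrite q1E; ring.
  rewrite (rk_quadratic_increment _ _ _ ab) => [|i j]; last exact: mulrC.
  congr (_ * _); apply: eq_bigr => i _; congr (_ * (_ * _)).
  have -> : \sum_j a i j * (l i * l j) = l i * \sum_j a i j * l j.
    by rewrite mulr_sumr; apply: eq_bigr => j _; ring.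
  by rewrite (hsav_Q scheme i); ring.
have stage_pairing i : inner mu (chem_pot L g C0 (Phi i) (Q i))
    (G (chem_pot L g C0 (Phi i) (Q i))) = B (Phi i) (k i) + 2 * (Q i * l i).
  have chem_dom := chem_pot_dom i; have chem_L2 := op_dom_L2 chem_dom.
  (* Once the image under [G] is replaced by [k i], the part with [L] gives [B (Phi i) (k i)] by
     self-adjointness. The part with [derive1 g] is twice [Q i * l i], because [l i] carries the
     factor 1/2. *)
  rewrite innerC -(ae_eq_inner (k_L2 i) (op_val_L2 chem_dom) chem_L2
    (hsav_k scheme i)) innerC.
  pose r := sav_root mu g C0 (Phi i).
  have -> : l i = (2 * r)^-1 * inner mu (derive1 g \o Phi i) (k i).
    (* Taking the zero function as second summand turns linearity into homogeneity. *)
    have := inner_linear (2 * r)^-1 (dgPhi_L2 i) (Lfun2_0 mu) (k_L2 i).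
    rewrite (hsav_l scheme i) => lE.
    transitivity (inner mu (fun x => (2 * r)^-1 * (derive1 g \o Phi i) x + 0)
        (k i)).
      by apply: eq_Rintegral => x _; rewrite addr0 [(2 * r)^-1 * _]mulrC.
    by rewrite lE inner0 addr0.
  have -> : chem_pot L g C0 (Phi i) (Q i) =
      fun x => (Q i / r) * (derive1 g \o Phi i) x + L (Phi i) x.
    by apply/funext => x; rewrite /chem_pot addrC mulrAC.
  rewrite inner_linear //; last exact: op_val_L2.
  rewrite L_self_adjoint // addrC invfM; congr (_ + _).
  by rewrite !mulrA [2 * Q i]mulrC mulfK ?pnatr_eq0 // mulrAC.
split; last first.
  apply: mulr_ge0_le0; first exact: ltW.
  by apply: sumr_le0 => i _; apply: mulr_ge0_le0 => //; exact: G_negative.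
(* The constant [C0] cancels in the difference, and the factor 1/2 of the energy cancels the 2 in
   [L_increment], while the 2 in [q_increment] remains and matches [stage_pairing]. *)
rewrite /energy !L_self_adjoint //.
transitivity (2^-1 * (B phi1 phi1 - B phi phi) + (q1 ^+ 2 - q ^+ 2)).
  by rewrite /B; ring.
rewrite L_increment q_increment mulrCA -mulrDr mulr_sumr -big_split /=.
congr (_ * _); apply: eq_bigr => i _.
by rewrite stage_pairing mulrCA mulKf ?pnatr_eq0 // -mulrDr.
Qed.
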